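(* For a positive integer $n$ let $N_{\rm ioc}(n)=\#\{w\in\mathfrak{o}' : N(w)=n\}$ be the number of imaginary integral octonions of norm $n$. Then $N_{\rm ioc}(1)=126$, $N_{\rm ioc}(2)=756$, $N_{\rm ioc}(3)=2072$, $N_{\rm ioc}(4)=4158$, $N_{\rm ioc}(5)=7560$, and $N_{\rm ioc}(6)=11592$.
   Context: $\mathfrak{C}_{\mathbb{Q}}=\bigoplus_{i=0}^7\mathbb{Q}e_i$ is the algebra of octonions (Cayley numbers) with unit $e_0$. For $x=\sum_{i=0}^7x_ie_i$ the norm is $N(x)=\sum_{i=0}^7x_i^2$; $x$ is called imaginary if $x_0=0$. The lattice $\mathfrak{o}\subset\mathfrak{C}_{\mathbb{Q}}$ of integral octonions is the $\mathbb{Z}$-span of $\alpha_0=e_0$, $\alpha_1=e_1$, $\alpha_2=e_2$, $\alpha_3=-e_4$, $\alpha_4=\frac12(e_1+e_2+e_3+e_4)$, $\alpha_5=\frac12(-e_0-e_1-e_4+e_5)$, $\alpha_6=\frac12(-e_0+e_1-e_2+e_6)$, $\alpha_7=\frac12(-e_0+e_2+e_4+e_7)$. $\mathfrak{o}'$ is the set of all imaginary elements of $\mathfrak{o}$. *)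

(* Defs.v *)
From mathcomp Require Import all_boot all_order all_algebra.
From mathcomp Require Import finmap boolp classical_sets functions cardinality.

Set Implicit Arguments.
Unset Strict Implicit.
Unset Printing Implicit Defensive.

Import GRing.Theory Num.Theory.

Local Open Scope classical_set_scope.
Local Open Scope ring_scope.

(* The rational octonions, as the coordinate space over e_0, ..., e_7: counting
   vectors of given norm in the lattice involves only the Q-linear structure,
   the basis and the norm form, so the product of the algebra is not defined. *)
Definition octonion := 'rV[rat]_8.

Definition octE (i : 'I_8) : octonion := delta_mx 0 i.

Definition octN (x : octonion) : rat := \sum_(i < 8) x 0 i ^+ 2.

Definition imaginary (x : octonion) : Prop := x 0 0 = 0.

(* The numerals are elements of 'I_8, which have the expected value as they are
   all less than 8. *)
Definition oct_alpha : 8.-tuple octonion :=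
  [tuple octE 0;
         octE 1;
         octE 2;
         - octE 4;
         2^-1 *: (octE 1 + octE 2 + octE 3 + octE 4);
         2^-1 *: (- octE 0 - octE 1 - octE 4 + octE 5);
         2^-1 *: (- octE 0 + octE 1 - octE 2 + octE 6);
         2^-1 *: (- octE 0 + octE 2 + octE 4 + octE 7)].

Definition integral_octonions : set octonion :=
  [set x | inIntSpan oct_alpha x].

Definition imaginary_integral_octonions : set octonion :=
  [set x | integral_octonions x /\ imaginary x].

(* [fset_set] is empty on infinite sets, so a nonzero value of [N_ioc n] also
   asserts that the set being counted is finite. *)
Definition N_ioc (n : nat) : nat :=
  #|` fset_set [set w | imaginary_integral_octonions w /\ octN w = n%:R] |%fset.

(* Main.v *)
Require Import Defs.
From mathcomp Require Import all_boot all_algebra.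
From mathcomp Require Import finmap classical_sets cardinality.
From mathcomp Require Import zify ring.

(** Write an imaginary octonion as half of an integer vector,
    w = (0, y_1, ..., y_7) / 2.  Expanding an integral combination of the basis
    alpha_0, ..., alpha_7 in coordinates shows that w is integral exactly when
    the y_i are integers whose parities satisfy four linear conditions over F_2,
    that is, when (y_1, ..., y_7) mod 2 is one of the eight words of a [7, 3]
    binary code ([imaginary_integralP]); this is the construction of the lattice
    E_7 from the simplex code.  As N(w) = (y_1^2 + ... + y_7^2) / 4, the number
    N_ioc(n) is the sum, over the eight codewords p, of the number of integer
    vectors y congruent to p modulo 2 with y_1^2 + ... + y_7^2 = 4 n.

    For a fixed parity word the vectors of given square norm are listed by
    choosing the entries from left to right, keeping track of the square norm
    that is left ([shell]).  Choosing absolute values first and signs afterwards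
    turns the length of this list into a short recursion ([shell_card]), and the
    six values follow from it by evaluation ([N_iocE]). *)

Set Implicit Arguments.
Unset Strict Implicit.
Unset Printing Implicit Defensive.

(** * Integer vectors of given parities and square norm *)

Section Shells.

Lemma uniq_flatten_fibers (S T : eqType) (key : T -> S) (s : seq S)
    (t : S -> seq T) :
    uniq s -> (forall x, uniq (t x)) ->
    (forall x, {in t x, forall y, key y = x}) ->
  uniq (flatten [seq t x | x <- s]).
Proof.
move=> us ut keyP; rewrite -(map_id (flatten _)) map_flatten -map_comp.
apply: (@allpairs_uniq_dep _ (fun=> T)) => //.
move=> _ _ /allpairsPdep[x [y [_ ty ->]]] /allpairsPdep[x' [y' [_ ty' ->]]] /=.
by move=> yy'; rewrite -(keyP _ _ ty) -(keyP _ _ ty') yy'.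
Qed.

Definition signs (m : nat) : seq int :=
  if m is 0 then [:: 0%R] else [:: Posz m; (- Posz m)%R].

Lemma mem_signs m a : (a \in signs m) = (absz a == m).
Proof. by case: m => [|m]; rewrite !inE; apply/idP/idP; lia. Qed.

Lemma uniq_signs m : uniq (signs m).
Proof. by case: m => [|m] //=; rewrite inE; lia. Qed.

Definition abs_values (b : bool) (s : nat) : seq nat :=
  [seq m <- iota 0 s.+1 | (odd m == b) && (m ^ 2 <= s)].

Lemma mem_abs_values b s m :
  (m \in abs_values b s) = (odd m == b) && (m ^ 2 <= s).
Proof. by rewrite mem_filter mem_iota; apply/idP/idP; nia. Qed.

Definition entries (b : bool) (s : nat) : seq int :=
  flatten [seq signs m | m <- abs_values b s].

Lemma mem_entries b s (x : int) :
  (x \in entries b s) = (odd (absz x) == b) && (absz x ^ 2 <= s).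
Proof.
rewrite -mem_abs_values; apply/flatten_mapP/idP => [[m mv]|xv].
  by rewrite mem_signs => /eqP ->.
by exists (absz x); rewrite // mem_signs.
Qed.

Lemma uniq_entries b s : uniq (entries b s).
Proof.
apply: (uniq_flatten_fibers (key := absz)) => [||m a].
- by rewrite filter_uniq ?iota_uniq.
- exact: uniq_signs.
- by rewrite mem_signs => /eqP.
Qed.

Fixpoint shell (p : seq bool) (s : nat) : seq (seq int) :=
  if p is b :: p' then
    [seq x :: y | x <- entries b s, y <- shell p' (s - absz x ^ 2)]
  else if s == 0 then [:: [::]] else [::].

Definition parities (y : seq int) : seq bool := [seq odd (absz a) | a <- y].

Definition sqnorm (y : seq int) : nat := sumn [seq absz a ^ 2 | a <- y].

Lemma mem_shell p s y :
  (y \in shell p s) = (parities y == p) && (sqnorm y == s).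
Proof.
elim: p s y => [|b p IHp] s [|a y] /=.
- by rewrite [RHS]eq_sym; case: (s == 0); rewrite inE.
- by case: (s == 0); rewrite ?inE.
- by apply/negP=> /allpairsPdep[x [z []]].
rewrite eqseq_cons; apply/allpairsPdep/idP.
  case=> x [z [/[!mem_entries]/andP[/eqP <- le_xs] + [-> ->]]].
  rewrite IHp => /andP[/eqP<- /eqP Ns].
  by rewrite !eqxx /sqnorm /= -/(sqnorm z) Ns subnKC.
case/andP=> /andP[/eqP <- /eqP py] /eqP <-.
exists a, y; split=> //=; first by rewrite mem_entries eqxx /sqnorm /= leq_addr.
by rewrite IHp py eqxx /sqnorm /= addKn eqxx.
Qed.

Lemma uniq_shell p s : uniq (shell p s).
Proof.
elim: p s => [|b p IHp] s /=; first by case: (s == 0).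
apply: allpairs_uniq_dep => [|x _|]; [exact: uniq_entries | exact: IHp |].
by move=> [x y] [x' y'] _ _ /= [-> ->].
Qed.

(** The entries a and - a leave the same square norm to the rest of the vector,
    so that only absolute values are enumerated and each is weighted by its
    number of signs; this keeps the evaluation small. *)
Fixpoint shell_card (p : seq bool) (s : nat) : nat :=
  if p is b :: p' then
    sumn [seq size (signs m) * shell_card p' (s - m ^ 2) | m <- abs_values b s]
  else s == 0.

Lemma size_shell p s : size (shell p s) = shell_card p s.
Proof.
elim: p s => [|b p IHp] s /=; first by case: (s == 0).
rewrite size_allpairs_dep map_flatten sumn_flatten -!map_comp; congr sumn.
apply: eq_map => m /=; rewrite -IHp.
by case: m => [|m] /=; rewrite ?addn0 ?abszN ?mul1n // mul2n -addnn.
Qed.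

Definition shells (C : seq (seq bool)) (s : nat) : seq (seq int) :=
  flatten [seq shell p s | p <- C].

Lemma mem_shells C s y :
  (y \in shells C s) = (parities y \in C) && (sqnorm y == s).
Proof.
apply/flatten_mapP/andP => [[p Cp]|[Cy Ns]].
  by rewrite mem_shell => /andP[/eqP -> ->].
by exists (parities y); rewrite // mem_shell eqxx.
Qed.

Lemma uniq_shells C s : uniq C -> uniq (shells C s).
Proof.
move=> uC; apply: (uniq_flatten_fibers (key := parities)) => // [p|p y].
  exact: uniq_shell.
by rewrite mem_shell => /andP[/eqP].
Qed.

Lemma size_shells C s : size (shells C s) = sumn [seq shell_card p s | p <- C].
Proof.
rewrite size_flatten /shape -map_comp; congr sumn.
by apply: eq_map => p; rewrite /= size_shell.
Qed.

End Shells.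

(** * Imaginary integral octonions and the simplex code *)

Section Lattice.
Local Open Scope ring_scope.
Import GRing.Theory Num.Theory.

Definition half_row n (y : seq int) : 'rV[rat]_n :=
  \row_(i < n) ((y`_i)%:~R / 2).

Lemma half_row_inj n y z : size y = n -> size z = n ->
  half_row n y = half_row n z -> y = z.
Proof.
move=> sy sz /rowP yz; apply: (@eq_from_nth _ 0); first by rewrite sy.
move=> i; rewrite sy => lti; have := yz (Ordinal lti).
by rewrite !mxE => /(mulIf _)/intr_inj; apply; rewrite invr_eq0.
Qed.

(** The coefficients are given as a function on all natural numbers, so that
    those of the expanded sum are indexed by plain numerals. *)
Lemma alpha_comb (f : nat -> int) :
  \sum_(i < 8) oct_alpha`_i *~ f i =
  half_row 8 [:: 2 * f 0%N - f 5 - f 6 - f 7; 2 * f 1%N + f 4 - f 5 + f 6;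
    2 * f 2 + f 4 - f 6 + f 7; f 4; - (2 * f 3) + f 4 - f 5 + f 7;
    f 5; f 6; f 7].
Proof.
rewrite !big_ord_recr big_ord0 /= -!scaler_int.
apply/rowP => i; rewrite !mxE -!val_eqE.
by case: i => -[|[|[|[|[|[|[|[|//]]]]]]]] lti /=; field.
Qed.

(** The entries are the seven nonzero linear forms in u, v, w, so this is the
    encoding map of the [7, 3] simplex code.  The order of the forms is imposed
    by the basis of the lattice: u, v, w sit at coordinates 3, 5, 6, where
    alpha_4, alpha_5, alpha_6 are the only contributors. *)
Definition codeword (u v w : bool) : seq bool :=
  [:: u (+) v (+) w; u (+) v; u; u (+) w; v; w; v (+) w].

Definition code : seq (seq bool) :=
  [seq codeword uv.1 uv.2 w
     | uv <- [seq (u, v) | u <- [:: false; true], v <- [:: false; true]],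
       w <- [:: false; true]].

Lemma codeP c : reflect (exists u v w, c = codeword u v w) (c \in code).
Proof.
apply: (iffP idP) => [/allpairsP[[[u v] w] [_ _ ->]]|[u [v [w ->]]]].
  by exists u, v, w.
by case: u; case: v; case: w.
Qed.

Lemma size_parities_code y : parities y \in code -> size y = 7%N.
Proof. by case/codeP=> u [v [w /(congr1 size)]]; rewrite size_map. Qed.

Lemma odd_abszD (x y : int) : odd `|x + y| = odd `|x| (+) odd `|y|.
Proof. lia. Qed.

Lemma even_half (x : int) : odd `|x| = false -> exists h, x = 2 * h.
Proof. by exists (x %/ 2)%Z; lia. Qed.

(** Modulo 2 the coordinates of an integral combination depend only on the
    coefficients of alpha_4, ..., alpha_7, and the vanishing of the coordinate
    over e_0 makes the last of these parities the sum of the two before it.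
    Conversely, the code conditions say that the four expressions that must be
    twice the coefficients of alpha_0, ..., alpha_3 are even. *)
Lemma imaginary_integralP w :
  imaginary_integral_octonions w <->
  exists2 y, parities y \in code & w = half_row 8 (0 :: y).
Proof.
split=> [[[a ->]]|[y /codeP[b4 [b5 [b6]]] + ->]].
  pose f k := a (inord k).
  under eq_bigr => i _ do rewrite -[i in a i]inord_val -/(f i).
  rewrite alpha_comb /imaginary mxE => /eqP.
  rewrite mulf_eq0 invr_eq0 orbF intr_eq0 => /= /eqP w0; rewrite w0.
  have f7p : odd `|f 7| = odd `|f 5| (+) odd `|f 6|.
    move/(congr1 (fun x : int => odd `|x|)): w0.
    rewrite !(odd_abszD, abszN) abszM oddM /=.
    by case: odd; case: odd; case: odd.
  eexists; last reflexivity.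
  apply/codeP; exists (odd `|f 4|), (odd `|f 5|), (odd `|f 6|).
  rewrite /parities /= /codeword.
  by do !congr cons; rewrite ?(odd_abszD, abszN, abszM) ?oddM //= ?f7p;
    case: odd; case: odd; case: odd.
case: y => [|y1 [|y2 [|y3 [|y4 [|y5 [|y6 [|y7 [|//]]]]]]]] //=.
move=> [p1 p2 p3 p4 p5 p6 p7].
have [|h0 h0E] := @even_half (y5 + y6 + y7).
  by rewrite !odd_abszD p5 p6 p7;
    move: b4 b5 b6 {p1 p2 p3 p4 p5 p6 p7} => [] [] [].
have [|h1 h1E] := @even_half (y1 - y3 + y5 - y6).
  by rewrite !(odd_abszD, abszN) p1 p3 p5 p6;
    move: b4 b5 b6 {p1 p2 p3 p4 p5 p6 p7} => [] [] [].
have [|h2 h2E] := @even_half (y2 - y3 + y6 - y7).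
  by rewrite !(odd_abszD, abszN) p2 p3 p6 p7;
    move: b4 b5 b6 {p1 p2 p3 p4 p5 p6 p7} => [] [] [].
have [|h3 h3E] := @even_half (y3 - y4 - y5 + y7).
  by rewrite !(odd_abszD, abszN) p3 p4 p5 p7;
    move: b4 b5 b6 {p1 p2 p3 p4 p5 p6 p7} => [] [] [].
pose f := nth 0 [:: h0; h1; h2; h3; y3; y5; y6; y7].
have fE : \sum_(i < 8) oct_alpha`_i *~ f i =
    half_row 8 [:: 0; y1; y2; y3; y4; y5; y6; y7].
  by rewrite alpha_comb; congr half_row; do !congr cons; rewrite /f /=; lia.
split; last by rewrite /imaginary mxE mul0r.
exists [ffun i : 'I_8 => f i].
by rewrite -fE; apply: eq_bigr => i _; rewrite ffunE.
Qed.

Lemma octN_half_row y : size y = 7%N ->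
  octN (half_row 8 (0 :: y)) = (sqnorm y)%:R / 4.
Proof.
move: y => [|y1 [|y2 [|y3 [|y4 [|y5 [|y6 [|y7 [|//]]]]]]]] //= _.
rewrite /octN !big_ord_recr big_ord0 /= !mxE /= /sqnorm /=.
rewrite !natrD !natrX !natr_absz !intr_norm !real_normK ?num_real //.
by field.
Qed.

Lemma octN_half_row_eq y n : size y = 7%N ->
  octN (half_row 8 (0 :: y)) = n%:R <-> sqnorm y = (4 * n)%N.
Proof.
move=> sy; rewrite octN_half_row //; split=> [Ny|->]; last first.
  by rewrite natrM; field.
apply/eqP; rewrite -(eqr_nat rat) natrM -Ny.
by apply/eqP; field.
Qed.

Lemma N_iocE n : N_ioc n = sumn [seq shell_card p (4 * n) | p <- code].
Proof.
pose ws := [seq half_row 8 (0 :: y) | y <- shells code (4 * n)].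
have uws : uniq ws.
  rewrite map_inj_in_uniq ?uniq_shells // => y z.
  rewrite !mem_shells => /andP[/size_parities_code sy _].
  move=> /andP[/size_parities_code sz _].
  by move/half_row_inj; rewrite /= sy sz => /(_ erefl erefl) [].
have <- : size ws = sumn [seq shell_card p (4 * n) | p <- code].
  by rewrite size_map size_shells.
rewrite -(undup_id uws) -card_fseq -[[fset x in ws]%fset]set_fsetK /N_ioc.
congr #|` fset_set _|%fset; apply/seteqP; split=> w /=.
  move=> [/imaginary_integralP[y cy ->] Ny].
  rewrite inE; apply: map_f; rewrite mem_shells cy /=.
  by apply/eqP; apply/octN_half_row_eq; first exact: size_parities_code.
rewrite inE => /mapP[y]; rewrite mem_shells => /andP[cy /eqP Ny] ->.
split; first by apply/imaginary_integralP; exists y.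
by apply/octN_half_row_eq; first exact: size_parities_code.
Qed.

End Lattice.

Theorem proposition3p5 :
  [/\ N_ioc 1 = 126, N_ioc 2 = 756 & N_ioc 3 = 2072] /\
  [/\ N_ioc 4 = 4158, N_ioc 5 = 7560 & N_ioc 6 = 11592].
Proof. by rewrite !N_iocE; vm_compute. Qed.
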